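(* Let $d\ge 1$, $k\ge 1$ and $m\ge 1$ be integers, and set $c(d,k)=(2^d-2)\left\lceil \tfrac23(k+1)\right\rceil+2$. Then any set of at least $c(d,k)\,(m-1)\,k\,d+k$ points of $\mathbb{Z}^d$ can be partitioned into $m$ disjoint subsets such that the intersection of their convex hulls contains at least $k$ points of $\mathbb{Z}^d$.
   Context: Convex hulls are taken in $\mathbb{R}^d$, with $\mathbb{Z}^d\subset\mathbb{R}^d$ the integer lattice. *)

(* Defs.v *)
From mathcomp Require Import all_boot all_order all_algebra.
From mathcomp Require Import boolp classical_sets functions cardinality.
From mathcomp Require Import reals convex.

Set Implicit Arguments.
Unset Strict Implicit.
Unset Printing Implicit Defensive.

Import Order.TTheory GRing.Theory Num.Theory.

Local Open Scope classical_set_scope.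
Local Open Scope ring_scope.

Definition conv_hull (R : numDomainType) (M : lmodType R) (X : set M) : set M :=
  smallest (@convex_set R M) X.

Definition lattice (R : realType) (d : nat) : set 'rV[R]_d :=
  [set x | x \is a mxOver Num.int].
Arguments lattice : clear implicits.

(* The absolute value only converts the ceiling of a positive rational from
   int to nat; the truncated subtraction is exact as soon as 0 < d. *)
Definition c (d k : nat) : nat :=
  ((2 ^ d - 2) * `|Num.ceil ((2 / 3) * (k + 1)%:R : rat)| + 2)%N.

(* Main.v *)
Require Import Defs.
From mathcomp Require Import all_boot all_order all_algebra.
From mathcomp Require Import boolp classical_sets functions cardinality.
From mathcomp Require Import interval_inference reals convex.
From mathcomp Require Import zify ring lra.

(** Write n = (m - 1) k d and h = c(d, k), and let A be a set of h n + k of the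
given points.

The key object is a set P of k lattice points which are deep in A: each lies in
the convex hull of every subset of A that misses at most n points. It comes from
a quantitative Helly property: if every h of finitely many convex sets have k
lattice points in common, so do all of them. Indeed h subsets of A missing at
most n points each share at least k points of A ([exists_deep_points]).

For the Helly property, a critical family of convex sets with fewer than k
common lattice points produces as many lattice points in convex position, whose
hull contains fewer than k further lattice points ([critical_vertices]); this is
a fact about finite convex geometries, and rests on the anti-exchange property
of convex hulls. The number of such vertices is at most c(d, k) by counting
midpoints inside each of the 2^d parity classes ([card_vertices]).

Given P, the parts are chosen greedily. A common vertex and d further points
for each element of P suffice, by Carathéodory's theorem, to put P in the hull
of k d + 1 points of what remains ([hull_cover]). Removing such a set costs only
k d units of depth ([deep_survives]): for p in P, a maximal subset of A whose
hull avoids p meets every subset of A with p in its hull, except when that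
subset contains p, and in this case k d points were enough. So P stays in the
hull of what remains after m - 1 choices, and the rest is the last part.

To work with finite sets, A is placed in a box of the lattice, translated to
d-tuples of natural numbers less than some M. *)

Section FiniteConvexity.
(* The names shared by finite and classical sets refer to finite sets here. *)
Import fintype mathcomp.boot.finset Order.TTheory GRing.Theory Num.Theory.
Set Implicit Arguments.
Unset Strict Implicit.
Unset Printing Implicit Defensive.

(** * Convex hulls of finite families of points *)

Section FiniteHull.
Local Open Scope ring_scope.
Variables (R : realFieldType) (V : lmodType R) (T : finType) (pt : T -> V).
Implicit Types (X Y C : {set T}) (x y p q t : T) (u v z : V).

(** Points are indexed by a finite type so that all weight functions share the
domain [T] and no enumeration of supports is needed. *)
Definition in_hull X v : Prop :=
  exists w : T -> R,
    [/\ forall t, 0 <= w t, forall t, t \notin X -> w t = 0,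
        \sum_t w t = 1 & \sum_t w t *: pt t = v].

Definition hull X : {set T} := [set t | `[< in_hull X (pt t) >]].

Lemma in_hull_pt X x : x \in X -> in_hull X (pt x).
Proof.
move=> xX; exists (fun t => (t == x)%:R); split.
- by move=> t; rewrite ler0n.
- by move=> t tX; case: eqVneq => // tx; rewrite -tx (negPf tX) in xX.
- by rewrite (bigD1 x) //= eqxx big1 ?addr0 // => t /negPf ->.
- rewrite (bigD1 x) //= eqxx scale1r big1 ?addr0 // => t /negPf ->.
  by rewrite scale0r.
Qed.

Lemma in_hullS X Y v : X \subset Y -> in_hull X v -> in_hull Y v.
Proof.
move=> /subsetP sXY [w [w0 wX w1 wv]]; exists w; split=> // t tY.
by apply: wX; apply: contra tY => /sXY.
Qed.

(** The convex combination of [u] and [v] is given with its weights not yet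
normalised, which spares divisions when solving a system for [z]. *)
Lemma in_hull_scaled X u v z (a b : R) :
    in_hull X u -> in_hull X v -> 0 <= a -> 0 <= b -> 0 < a + b ->
  (a + b) *: z = a *: u + b *: v -> in_hull X z.
Proof.
move=> [w [w0 wX w1 wu]] [w' [w'0 w'X w'1 w'v]] a0 b0 ab0 ez.
exists (fun t => (a + b)^-1 * (a * w t + b * w' t)); split.
- by move=> t; rewrite mulr_ge0 ?invr_ge0 ?addr_ge0 ?mulr_ge0 // ltW.
- by move=> t tX; rewrite wX ?w'X // !mulr0 addr0 mulr0.
- by rewrite -mulr_sumr big_split -!mulr_sumr /= w1 w'1 !mulr1 mulVf ?gt_eqF.
- under eq_bigr do rewrite -scalerA scalerDl -!scalerA.
  rewrite -scaler_sumr big_split /= -!scaler_sumr wu w'v -ez.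
  by rewrite scalerA mulVf ?gt_eqF // scale1r.
Qed.

Lemma in_hull_sum (I : finType) (c : I -> R) (z : I -> V) X :
    (forall i, 0 <= c i) -> \sum_i c i = 1 ->
    (forall i, c i != 0 -> in_hull X (z i)) ->
  in_hull X (\sum_i c i *: z i).
Proof.
move=> c0 c1 hz.
have /choice[W HW] : forall i, exists w : T -> R, c i != 0 ->
    [/\ forall t, 0 <= w t, forall t, t \notin X -> w t = 0,
        \sum_t w t = 1 & \sum_t w t *: pt t = z i].
  move=> i; have [_|/hz[w Hw]] := eqVneq (c i) 0; last by exists w.
  by exists (fun=> 0).
exists (fun t => \sum_i c i * W i t); split.
- move=> t; apply: sumr_ge0 => i _; have [->|/HW[W0 _ _ _]] := eqVneq (c i) 0.
    by rewrite mul0r.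
  by rewrite mulr_ge0.
- move=> t tX; rewrite big1 // => i _.
  have [->|/HW[_ WX _ _]] := eqVneq (c i) 0; first by rewrite mul0r.
  by rewrite WX ?mulr0.
- rewrite exchange_big /= -c1; apply: eq_bigr => i _; rewrite -mulr_sumr.
  by have [->|/HW[_ _ -> _]] := eqVneq (c i) 0; rewrite ?mul0r ?mulr1.
- under eq_bigr do rewrite scaler_suml.
  rewrite exchange_big /=; apply: eq_bigr => i _.
  under eq_bigr do rewrite -scalerA.
  rewrite -scaler_sumr.
  by have [->|/HW[_ _ _ ->]] := eqVneq (c i) 0; rewrite ?scale0r.
Qed.

Lemma in_hull_trans X Y v :
  (forall x, x \in X -> in_hull Y (pt x)) -> in_hull X v -> in_hull Y v.
Proof.
move=> XY [w [w0 wX w1 <-]]; apply: in_hull_sum => // t wt.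
by apply: XY; apply: contraNT wt => /wX ->.
Qed.

(** The dichotomy is there because nothing is left to renormalise when [x]
carries all the weight. *)
Lemma in_hull_split X x v : in_hull X v ->
  v = pt x \/ exists (a : R) z,
    [/\ 0 <= a < 1, in_hull (X :\ x) z & v = a *: pt x + (1 - a) *: z].
Proof.
move=> [w [w0 wX w1 wv]].
have ew : w x + \sum_(t | t != x) w t = 1 by rewrite -w1 [RHS](bigD1 x).
have ev : w x *: pt x + \sum_(t | t != x) w t *: pt t = v.
  by rewrite -wv [RHS](bigD1 x).
have s0 : 0 <= \sum_(t | t != x) w t by apply: sumr_ge0.
case: (ltP (w x) 1) => [wx1|wx1]; last first.
  have /eqP : \sum_(t | t != x) w t = 0 by lra.
  rewrite psumr_eq0 // => /allP z0; left.
  have wx : w x = 1 by lra.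
  rewrite -ev wx scale1r big1 ?addr0 // => t tx.
  by have := z0 t (mem_index_enum t); rewrite tx => /eqP ->; rewrite scale0r.
right; exists (w x), ((1 - w x)^-1 *: \sum_(t | t != x) w t *: pt t).
have n0 : 1 - w x != 0 by rewrite subr_eq0 gt_eqF.
split; first by rewrite w0.
  exists (fun t => (1 - w x)^-1 * (if t == x then 0 else w t)); split.
  - move=> t; rewrite mulr_ge0 ?invr_ge0 ?subr_ge0 ?(ltW wx1) //; by case: ifP.
  - move=> t; rewrite !inE negb_and negbK; case: eqP => [_|_ /= /wX ->];
      by rewrite mulr0.
  - rewrite -mulr_sumr (bigD1 x) //= eqxx add0r.
    rewrite (eq_bigr w); last by move=> t /negPf ->.
    by apply: (mulfI n0); rewrite mulrA mulfV // mul1r mulr1 -ew addrC addKr.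
  - rewrite (bigD1 x) //= eqxx mulr0 scale0r add0r scaler_sumr.
    by apply: eq_bigr => t /negPf ->; rewrite scalerA.
by rewrite scalerA mulfV // scale1r ev.
Qed.

Lemma hullP X x : reflect (in_hull X (pt x)) (x \in hull X).
Proof. by rewrite inE; apply: asboolP. Qed.

Lemma sub_hull X : X \subset hull X.
Proof. by apply/subsetP => x xX; apply/hullP/in_hull_pt. Qed.

Lemma hullS X Y : X \subset Y -> hull X \subset hull Y.
Proof.
by move=> sXY; apply/subsetP => x /hullP hx; apply/hullP/(in_hullS sXY).
Qed.

Lemma hull_sub X C : hull C \subset C -> X \subset C -> hull X \subset C.
Proof. by move=> cC sXC; apply: subset_trans (hullS sXC) cC. Qed.

Lemma hull_hull X : hull (hull X) \subset hull X.
Proof.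
apply/subsetP => x /hullP hx; apply/hullP/(in_hull_trans _ hx).
by move=> t /hullP.
Qed.

(** If [p] and [q] differ, each is a combination, with weight less than [1], of
the other and of a point of the hull of [C]; eliminating [q] from these two
equations writes [p] as a convex combination of those two points. *)
Lemma anti_exchange C p q : ~ in_hull C (pt p) ->
  in_hull (p |: C) (pt q) -> in_hull (q |: C) (pt p) -> pt p = pt q.
Proof.
have sD x : (x |: C) :\ x \subset C.
  by apply/subsetP => t; rewrite !inE => /andP[/negPf ->].
move=> pC /(in_hull_split p)[//|[a [z [/andP[a0 a1] /(in_hullS (sD p)) hz eq]]]].
move=> /(in_hull_split q)[//|[b [z' [/andP[b0 b1] /(in_hullS (sD q)) hz' ep]]]].
case: pC; apply: (in_hull_scaled (a := b * (1 - a)) (b := 1 - b) hz hz').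
- by nra.
- by lra.
- by nra.
- rewrite -scalerA.
  have -> : (1 - a) *: z = pt q - a *: pt p by rewrite eq addrAC subrr add0r.
  have -> : (1 - b) *: z' = pt p - b *: pt q.
    by rewrite ep addrAC subrr add0r.
  rewrite scalerBr scalerA [RHS]addrC [RHS]addrA subrK.
  have -> : b * (1 - a) + (1 - b) = 1 - b * a by ring.
  by rewrite scalerBl scale1r.
Qed.

(** A vertex is an extreme point of its hull: otherwise both ends of the
segment give a positive weight to the other vertices, and solving for [x] puts
it in their hull. *)
Lemma extreme_midpoint X x u v : ~ in_hull (X :\ x) (pt x) ->
  in_hull X u -> in_hull X v -> u + v = 2 *: pt x -> u = pt x.
Proof.
move=> nx /(in_hull_split x)[//|[a [z [/andP[a0 a1] hz eu]]]].
move=> /(in_hull_split x)[->|[b [z' [/andP[b0 b1] hz' ev]]] euv].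
  by rewrite scaler_nat mulr2n => /addIr.
case: nx; apply: (in_hull_scaled (a := 1 - a) (b := 1 - b) hz hz');
  [lra | lra | lra |].
have -> : (1 - a) *: z = u - a *: pt x by rewrite eu addrAC subrr add0r.
have -> : (1 - b) *: z' = v - b *: pt x by rewrite ev addrAC subrr add0r.
rewrite [RHS]addrACA euv -opprD -scalerDl -scalerBl; congr (_ *: _); ring.
Qed.

Hypothesis pt_inj : injective pt.

(** The shelling property of a convex geometry. A point [p] for which the hull
of [p |: C] is smallest works, since by anti-exchange any further new point [q]
would give a strictly smaller hull. *)
Lemma closed_extend C : hull C \subset C -> C != [set: T] ->
  exists2 p, p \notin C & hull (p |: C) \subset p |: C.
Proof.
move=> cC; rewrite -properT => /properP[_ [p0 _ p0C]].
case: (@arg_minnP T p0 (fun p => p \notin C) (fun p => #|hull (p |: C)|) p0C).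
move=> p pC pmin.
exists p => //; apply/subsetP => q qh.
case: (boolP (q \in C)) => [qC|qC]; first exact: setU1r.
rewrite in_setU1.
case: eqVneq => //= qp; have := pmin _ qC; rewrite leqNgt => /negP; case.
apply: proper_card; apply/properP; split.
  apply: hull_sub (hull_hull _) _; apply/subsetP => t.
  case/setU1P => [->|tC] //.
  by apply/hullP/in_hull_pt/setU1r.
exists p; first by apply/hullP/in_hull_pt/setU11.
apply/negP => /hullP ph; move/hullP: qh => qh.
move/eqP: qp; case; apply: pt_inj; apply/esym; apply: anti_exchange qh ph.
by move=> pC'; move/negP: pC; apply; apply: (subsetP cC); apply/hullP.
Qed.

(** A critical family of convex sets (every member is needed to cut the
intersection down to [K]) yields as many points in convex position, whose hull
adds no point outside [K]. Enlarge the members by single points as long as the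
intersection stays [K]; at the end each [C i] can only be extended by some
[x i] lying in all the other members. The hull of the points [x i] is then
contained in each [x i |: C i], so its other points lie in all members. *)
Lemma critical_vertices (I : finType) (J : {set I}) (C : I -> {set T}) K :
    (forall i, i \in J -> hull (C i) \subset C i) ->
    \bigcap_(i in J) C i = K ->
    (forall i, i \in J -> \bigcap_(l in J :\ i) C l != K) ->
  exists X : {set T}, [/\ #|X| = #|J|, forall x, x \in X -> x \notin hull (X :\ x)
    & hull X :\: X \subset K].
Proof.
have [n] := ubnP (\sum_(i in J) #|~: C i|); elim: n => // n IHn in C *.
move=> le_n cC capC critC.
have neT i : i \in J -> C i != [set: T].
  move=> iJ; apply: contraNneq (critC i iJ) => CT.
  by rewrite -capC [X in _ == X](big_setD1 i) //= CT setTI.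
pose good i p := [/\ p \notin C i, hull (p |: C i) \subset p |: C i &
    forall l, l \in J -> l != i -> p \in C l].
have [allg|] := pselect (forall i, i \in J -> exists p, good i p).
  have [J0|[i0 i0J]] := set_0Vmem J.
    exists set0; rewrite J0 !cards0; split=> //; first by move=> x; rewrite inE.
    by rewrite setD0 -capC J0 big_set0 subsetT.
  have [p0 _] := allg i0 i0J.
  have /choice[x Hx] : forall i, exists p, i \in J -> good i p.
    move=> i; case: (boolP (i \in J)) => [/allg[p gp]|_]; first by exists p.
    by exists p0.
  have xinj : {in J &, injective x}.
    move=> i l iJ lJ exil; apply/eqP; apply: contraT => neil.
    have [xC _ _] := Hx i iJ; have [_ _ /(_ i iJ neil)] := Hx l lJ.
    by rewrite -exil (negPf xC).
  have subC i : i \in J -> (x @: J) :\ x i \subset C i.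
    move=> iJ; apply/subsetP => y /setD1P[ne /imsetP[l lJ el]].
    rewrite {}el in ne *; case: (Hx l lJ) => _ _ H; apply: H => //.
    by apply: contraNneq ne => ->.
  exists (x @: J); split; first exact: card_in_imset.
    move=> _ /imsetP[i iJ ->]; have [xC _ _] := Hx i iJ.
    by apply: contra xC; apply/subsetP/hull_sub/subC => //; apply: cC.
  apply/subsetP => y /setDP[yh yX]; rewrite -capC; apply/bigcapP => i iJ.
  have [_ /subsetP cl _] := Hx i iJ.
  have : y \in x i |: C i.
    apply: cl; move: y yh {yX}; apply/subsetP/hullS.
    by rewrite -(setD1K (imset_f x iJ)) setUS ?subC.
  by case/setU1P => // eyx; move: yX; rewrite eyx imset_f.
move=> /existsNP[i] /not_implyP[iJ nog].
have [p pC pcl] := closed_extend (cC i iJ) (neT i iJ).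
have /existsNP[l] : ~ (forall l, l \in J -> l != i -> p \in C l).
  by move=> H; apply: nog; exists p.
move=> /not_implyP[lJ /not_implyP[li /negP plC]].
pose C' := fun t : I => if t == i then p |: C i else C t.
(* Replacing C i by C' i keeps the intersection because p misses C l, and
   keeps every member critical because the partial intersections only grow. *)
have C'E r : r != i -> C' r = C r by rewrite /C' => /negPf ->.
have C'i : C' i = p |: C i by rewrite /C' eqxx.
have CC' r : C r \subset C' r.
  by rewrite /C'; case: eqP => [->|//]; apply: subsetUr.
apply: (IHn C').
- rewrite (big_setD1 i) //= C'i.
  rewrite (eq_bigr (fun r => #|~: C r|)); last by move=> r /setD1P[/C'E ->].
  move: le_n; rewrite (big_setD1 i) //=.
  have : (#|~: (p |: C i)| < #|~: C i|)%N.
    by rewrite proper_card // properC properUr // sub1set.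
  by lia.
- by move=> r rJ; rewrite /C'; case: eqP => // _; apply: cC.
- rewrite -capC (big_setD1 i) //= [RHS](big_setD1 i) //= C'i.
  rewrite (eq_bigr C); last by move=> r /setD1P[/C'E ->].
  rewrite setIUl (_ : [set p] :&: _ = set0) ?set0U //.
  apply/eqP; rewrite setI_eq0 disjoints1; apply: contra plC.
  by move/bigcapP; apply; rewrite !inE li.
- move=> r rJ; apply: contra (critC r rJ) => /eqP eqK; rewrite eqEsubset.
  apply/andP; split.
    rewrite -eqK; apply/bigcapsP => s sJ; apply: subset_trans (CC' s).
    exact: bigcap_inf.
  by rewrite -capC; apply/bigcapsP => s /setD1P[_ sJ]; apply: bigcap_inf.
Qed.

End FiniteHull.

(** * Lattice polytopes with few lattice points that are not vertices *)

(** The injection [phi] orders [Q] linearly. The midpoints with the least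
element [a] are at most the midpoint of [a] and the greatest element [b], and
the midpoints of [b] with the elements other than [a] are beyond it: this makes
[(#|Q| - 1) + (#|Q| - 2)] distinct midpoints. *)
Lemma card_midpoints (T : finType) (phi : T -> nat) (mid : T -> T -> T)
    (Q K : {set T}) : injective phi ->
    {in Q &, forall u v, phi u + phi v = 2 * phi (mid u v)} ->
    {in Q &, forall u v, u != v -> mid u v \in K} ->
  2 * #|Q| <= #|K| + 3.
Proof.
move=> phi_inj phi_mid midK.
have [Q1|Q2] := leqP #|Q| 1; first by lia.
have [q0 q0Q] : exists q, q \in Q by apply/card_gt0P; lia.
case: (@arg_minnP T q0 (mem Q) phi q0Q) => a /= aQ amin.
case: (@arg_maxnP T q0 (mem Q) phi q0Q) => b /= bQ bmax.
have mid_inj u v w : u \in Q -> v \in Q -> w \in Q ->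
    mid u v = mid u w -> v = w.
  move=> uQ vQ wQ e; apply: phi_inj.
  by have := phi_mid _ _ uQ vQ; rewrite e -phi_mid //; lia.
have neab : a != b.
  apply: contraTneq Q2 => eab; rewrite -leqNgt.
  apply/card_le1_eqP => u v uQ vQ; apply: phi_inj.
  have := (amin _ uQ, amin _ vQ, bmax _ uQ, bmax _ vQ); rewrite eab /=.
  by case=> -[[]] /=; lia.
pose K1 := [set mid a u | u in Q :\ a].
pose K2 := [set mid b u | u in Q :\ a :\ b].
have cQ : #|Q| = #|Q :\ a|.+1 by rewrite [LHS](cardsD1 a) aQ.
have cQa : #|Q :\ a| = #|Q :\ a :\ b|.+1.
  by rewrite [LHS](cardsD1 b) !inE eq_sym neab bQ.
have cK1 : #|K1| = #|Q :\ a|.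
  apply: card_in_imset => u v /setD1P[_ uQ] /setD1P[_ vQ]; exact: mid_inj.
have cK2 : #|K2| = #|Q :\ a :\ b|.
  apply: card_in_imset => u v /setD1P[_ /setD1P[_ uQ]] /setD1P[_ /setD1P[_ vQ]].
  exact: mid_inj.
have dis : K1 :&: K2 = set0.
  apply/setP => t; rewrite !inE; apply/negP => /andP[/imsetP[u uQ tu]].
  case/imsetP => v /setD1P[vb /setD1P[va vQ]] tv.
  case/setD1P: uQ => ua uQ.
  have := phi_mid _ _ aQ uQ; rewrite -tu tv -phi_mid //.
  have := (bmax _ uQ, amin _ vQ) => /= -[ub av] e.
  by case/eqP: va; apply: phi_inj; lia.
have sK : K1 :|: K2 \subset K.
  apply/subsetP => t /setUP[] /imsetP[u].
    by case/setD1P => ua uQ ->; apply: midK; rewrite // eq_sym.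
  by case/setD1P => ub /setD1P[ua uQ] ->; apply: midK; rewrite // eq_sym.
have := subset_leq_card sK; rewrite cardsU dis cards0; lia.
Qed.

Lemma card_fibres (T P : finType) (par : T -> P) (Y : {set T}) :
  #|Y| = \sum_c #|[set y in Y | par y == c]|.
Proof.
rewrite -sum1_card (partition_big par xpredT) //=; apply: eq_bigr => c _.
by rewrite -sum1_card; apply: eq_bigl => y; rewrite inE.
Qed.

Lemma base_expansion_inj d M (f g : 'I_d -> nat) :
    (forall j, f j < M) -> (forall j, g j < M) ->
  \sum_j f j * M ^ j = \sum_j g j * M ^ j -> f =1 g.
Proof.
elim: d f g => [|d IHd] f g fM gM; first by move=> _ [].
have shift (h : 'I_d.+1 -> nat) :
    \sum_j h j * M ^ j = (\sum_(j < d) h (lift ord0 j) * M ^ j) * M + h ord0.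
  rewrite big_ord_recl expn0 muln1 addnC; congr (_ + _).
  by rewrite big_distrl; apply: eq_bigr => j _; rewrite /= expnSr mulnA.
rewrite !shift => e.
have M0 : 0 < M by apply: leq_trans (fM ord0).
have := congr1 (fun n => n %/ M) e.
rewrite !divnMDl // !divn_small // !addn0 => /IHd eS.
have := congr1 (fun n => n %% M) e; rewrite !modnMDl !modn_small // => e0.
by move=> j; case: (unliftP ord0 j) => [i|] -> //; apply: eS.
Qed.

Lemma ceil_two_thirds_ge k :
  2 * (k + 1) <= 3 * `|Num.ceil ((2 / 3) * (k + 1)%:R : rat)%R|.
Proof.
pose z : rat := ((2 / 3) * (k + 1)%:R)%R; set x := `|_|.
have : (z <= x%:R)%R.
  by apply: le_trans (ceil_ge _) _; rewrite pmulrn ler_int /x abszE ler_norm.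
rewrite /z => h.
suff : ((2 * (k + 1))%:R <= (3 * x)%:R :> rat)%R by rewrite ler_nat.
by rewrite !natrM; lra.
Qed.

(** Here [D] is the number of parity classes, [j] the number of lattice points
that are not vertices, and [y] bounds the size of a class. The inequality fails
for [j = 1], where [x = y = 2] is possible. *)
Lemma leq_parity_count D x j y : 4 <= D -> 2 * (j + 2) <= 3 * x -> j != 1 ->
  2 * y <= j + 3 -> D * y <= (D - 2) * x + 2 + j.
Proof.
move=> D4 hx j1 hy.
have xy : y <= x by lia.
have [e ->] : exists e, D = 4 + e by exists (D - 4); lia.
have : e * y <= e * x by rewrite leq_mul2l xy orbT.
have -> : 4 + e - 2 = 2 + e by lia.
by rewrite !mulnDl; lia.
Qed.

Section Grid.
Variables (R : realFieldType) (d M Z : nat).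
Local Notation T := {ffun 'I_d -> 'I_M}.
Implicit Types (f g : T) (X Y : {set T}).

Definition grid_pt f : 'rV[R]_d := (\row_j ((f j : nat)%:R - Z%:R))%R.

Definition parity f : {ffun 'I_d -> bool} := [ffun j => odd (f j)].

Lemma half_sum_lt (i j : 'I_M) : (i + j)./2 < M.
Proof. by have := (ltn_ord i, ltn_ord j) => -[]; lia. Qed.

Definition midpoint f g : T := [ffun j => Ordinal (half_sum_lt (f j) (g j))].

(** Base [M] expansion: a linear form that is injective on the grid, giving the
linear order on which midpoints are counted. *)
Definition code f := \sum_j f j * M ^ j.

Lemma grid_pt_inj : injective grid_pt.
Proof.
move=> f g e; apply/ffunP => j; apply/val_inj/eqP.
have /rowP/(_ j) := e; rewrite !mxE => /(addIr _)/eqP.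
by rewrite eqr_nat.
Qed.

Lemma code_inj : injective code.
Proof.
move=> f g /base_expansion_inj e; apply/ffunP => j; apply: val_inj.
by apply: e => i; apply: ltn_ord.
Qed.

Lemma double_midpoint f g j : parity f = parity g ->
  f j + g j = 2 * midpoint f g j.
Proof.
move/ffunP/(_ j); rewrite !ffunE /= => e.
by rewrite mul2n -[LHS]odd_double_half oddD e addbb.
Qed.

Lemma grid_pt_midpoint f g : parity f = parity g ->
  (grid_pt f + grid_pt g = 2 *: grid_pt (midpoint f g))%R.
Proof.
move=> e; apply/rowP => j; rewrite !mxE.
have := congr1 (fun n => n%:R : R)%R (double_midpoint j e).
by rewrite natrM natrD /=; lra.
Qed.

Lemma code_midpoint f g : parity f = parity g ->
  code f + code g = 2 * code (midpoint f g).
Proof.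
move=> e; rewrite /code -big_split big_distrr; apply: eq_bigr => j _ /=.
by rewrite -mulnDl (double_midpoint j e) mulnA.
Qed.

Lemma card_line_vertices X : d = 1 ->
  (forall f, f \in X -> f \notin hull grid_pt (X :\ f)) -> #|X| <= 2.
Proof.
move=> d1 extX; rewrite leqNgt; apply/negP => X3.
have j : 'I_d by rewrite d1; apply: ord0.
have eqf f g : f j = g j :> nat -> f = g.
  move=> e; apply/ffunP => i; have -> : i = j; last exact: val_inj.
  by apply: val_inj; have := (ltn_ord i, ltn_ord j) => -[] /=; lia.
have [f0 f0X] : exists f, f \in X.
  by apply/card_gt0P; apply: leq_trans X3.
case: (@arg_minnP T f0 (mem X) (fun f => f j) f0X) => a /= aX amin.
case: (@arg_maxnP T f0 (mem X) (fun f => f j) f0X) => b /= bX bmax.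
have : X :\ a :\ b != set0.
  rewrite -card_gt0; have := cardsD1 a X; have := cardsD1 b (X :\ a).
  by case: (_ \in _); case: (_ \in _); lia.
case/set0Pn => f; rewrite !inE => /and3P[fb fa fX].
have /negP := extX f fX; apply; apply/hullP.
have haf : a j < f j.
  by rewrite ltn_neqAle amin // andbT; apply: contraNneq fa => /eqf ->.
have hfb : f j < b j.
  by rewrite ltn_neqAle (bmax f) // andbT; apply: contraNneq fb => /eqf ->.
have haf' : ((a j)%:R < (f j)%:R :> R)%R by rewrite ltr_nat.
have hfb' : ((f j)%:R < (b j)%:R :> R)%R by rewrite ltr_nat.
have ha : in_hull grid_pt (X :\ f) (grid_pt a).
  by apply: in_hull_pt; rewrite !inE eq_sym fa.
have hb : in_hull grid_pt (X :\ f) (grid_pt b).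
  by apply: in_hull_pt; rewrite !inE eq_sym fb.
apply: (in_hull_scaled (a := ((b j)%:R - (f j)%:R)%R)
  (b := ((f j)%:R - (a j)%:R)%R) ha hb); [lra | lra | lra |].
apply/rowP => i; have -> : i = j.
  by apply: val_inj; have := (ltn_ord i, ltn_ord j) => -[] /=; lia.
rewrite !mxE; ring.
Qed.

(** The parity argument of Doignon, Bell and Scarf, with [j] non-vertices. The
midpoint of two lattice points of the polytope with the same parity is a
lattice point of it, and it is not a vertex. So each parity class, vertices and
non-vertices together, has at most [(j + 3) / 2] points, and summing over the
[2 ^ d] classes bounds the number of vertices plus [j]. This is enough when
[d >= 2] and [j] is not [1]; a line has at most two vertices, and for [j = 1]
one class is a singleton. *)
Lemma card_vertices X k : 0 < d ->
    (forall f, f \in X -> f \notin hull grid_pt (X :\ f)) ->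
    #|hull grid_pt X :\: X| < k -> #|X| <= c d k.
Proof.
move=> d0 extX; set Y := hull grid_pt X; set K := Y :\: X => Kk.
have hx := ceil_two_thirds_ge k; rewrite /c; set x := `|_| in hx *.
have [d1|d2] := eqVneq d 1.
  exact: leq_trans (card_line_vertices d1 extX) (leq_addl _ _).
have D4 : 4 <= 2 ^ d by rewrite -[4]/(2 ^ 2) leq_exp2l //; lia.
have XY : X \subset Y by apply: sub_hull.
have cY : #|Y| = #|X| + #|K|.
  by rewrite /K -(cardsID X Y) (setIidPr XY).
pose fib p := [set f in Y | parity f == p].
have midK f g : f \in Y -> g \in Y -> parity f = parity g -> f != g ->
    midpoint f g \in K.
  move=> fY gY efg nefg; have e := grid_pt_midpoint efg.
  move/hullP: (fY) => hf; move/hullP: (gY) => hg.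
  rewrite inE; apply/andP; split; last first.
    apply/hullP/(in_hull_scaled (a := 1%R) (b := 1%R) hf hg) => //.
    by rewrite !scale1r e.
  apply/negP => mX; have /hullP nm := extX _ mX.
  have /grid_pt_inj fm := extreme_midpoint nm hf hg e.
  have : grid_pt g = grid_pt (midpoint f g).
    by apply: (extreme_midpoint nm hg hf); rewrite addrC.
  by move/grid_pt_inj; rewrite -fm => gf; rewrite gf eqxx in nefg.
have fibK p : #|fib p| <= (#|K| + 3)./2.
  rewrite geq_half_double -mul2n.
  apply: (card_midpoints (phi := code) (mid := midpoint)) code_inj _ _.
    move=> f g; rewrite !inE => /andP[_ /eqP fp] /andP[_ /eqP gp].
    by apply: code_midpoint; rewrite fp.
  move=> f g; rewrite inE => /andP[fY /eqP fp]; rewrite inE => /andP[gY /eqP gp].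
  by apply: midK; rewrite // fp.
have cP : #|{: {ffun 'I_d -> bool}}| = 2 ^ d.
  by rewrite card_ffun card_bool card_ord.
have cYs : #|Y| = \sum_p #|fib p| by apply: card_fibres.
have [K1|K1] := eqVneq #|K| 1; last first.
  suff : 2 ^ d * ((#|K| + 3)./2) <= (2 ^ d - 2) * x + 2 + #|K|.
    move=> h; suff : #|Y| <= 2 ^ d * ((#|K| + 3)./2) by lia.
    by rewrite cYs -cP -sum_nat_const; apply: leq_sum => p _; apply: fibK.
  by apply: leq_parity_count => //; lia.
(* With a single non-vertex q, a lattice point of the parity of q would have
   its midpoint with q equal to q; so the class of q is reduced to q. *)
have /eqP/cards1P[q Kq] := K1.
have qK : q \in K by rewrite Kq set11.
have fibq : #|fib (parity q)| <= 1.
  have qY : q \in Y by move: qK; rewrite inE => /andP[].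
  have sub f : f \in fib (parity q) -> f = q.
    rewrite inE => /andP[fY /eqP fp]; apply/eqP; apply: contraT => nefq.
    have := midK _ _ fY qY fp nefq; rewrite Kq => /set1P em.
    have := code_midpoint fp; rewrite em => ec.
    by case/eqP: nefq; apply/code_inj/(@addIn (code q)); rewrite ec mul2n addnn.
  by apply/card_le1_eqP => f g /sub -> /sub ->.
have : #|Y| <= 1 + (2 ^ d - 1) * 2.
  rewrite cYs (bigD1 (parity q)) //= leq_add //.
  rewrite -cP -cardsT (cardsD1 (parity q)) inE add1n subn1 /=.
  rewrite -sum_nat_const [X in _ <= X](eq_bigl (fun p => p != parity q)).
    by apply: leq_sum => p _; rewrite (leq_trans (fibK p)) ?K1.
  by move=> p; rewrite !inE andbT.
by nia.
Qed.
End Grid.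

(** * Deep points *)

Local Open Scope ring_scope.

Lemma exists_subset_card (T : finType) (X : {set T}) k : (k <= #|X|)%N ->
  exists2 Y : {set T}, Y \subset X & #|Y| = k.
Proof.
move=> kX; exists [set x in take k (enum X)].
  by apply/subsetP => x; rewrite inE => /mem_take; rewrite mem_enum.
rewrite cardsE (card_uniqP _) ?take_uniq ?enum_uniq // size_takel //.
by rewrite -cardE.
Qed.

Lemma card_bigcup_leq (I T : finType) (J : {set I}) (F : I -> {set T}) n :
  (forall i, i \in J -> (#|F i| <= n)%N) ->
  (#|\bigcup_(i in J) F i| <= #|J| * n)%N.
Proof.
move=> Fn; apply: (@leq_trans (\sum_(i in J) #|F i|)).
  elim/big_rec2: _ => [|i X m _ Xm]; first by rewrite cards0.
  by rewrite (leq_trans (leq_card_setU _ _)) // leq_add2l.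
by rewrite -sum_nat_const; apply: leq_sum.
Qed.

Section Depth.
Variables (R : realFieldType) (V : lmodType R) (T : finType) (pt : T -> V).
Implicit Types (A B X : {set T}) (p x : T) (v : V).

(** A form of Tukey depth that does not mention halfspaces: by separation, [p]
is [n]-deep when every closed halfspace containing it has more than [n] points
of [A]. *)
Definition deep A n p :=
  forall B, B \subset A -> (#|A :\: B| <= n)%N -> in_hull pt B (pt p).

(** The centrepoint argument. Among the hulls of the sets [B] missing at most
[n] points of [A], a family minimal with fewer than [k] common points has at
most [h] members by [critical_vertices]; but [h] such sets [B] miss at most
[h * n] points of [A] altogether, hence share at least [k]. *)
Lemma exists_deep_points A h k n : injective pt ->
    (forall X, (forall x, x \in X -> x \notin hull pt (X :\ x)) ->
       (#|hull pt X :\: X| < k)%N -> (#|X| <= h)%N) ->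
    (h * n + k <= #|A|)%N ->
  exists2 P : {set T}, #|P| = k & forall p, p \in P -> deep A n p.
Proof.
move=> pt_inj vertices_leq cA.
pose I0 := [set B : {set T} | (B \subset A) && (#|A :\: B| <= n)%N].
suff : (k <= #|\bigcap_(B in I0) hull pt B|)%N.
  case/exists_subset_card => P /subsetP sP cP; exists P => // p /sP pI B sB cB.
  by apply/hullP; move/bigcapP: pI; apply; rewrite inE sB.
rewrite leqNgt; apply/negP => small.
have [J /minsetP[Jsmall Jmin] sJ] :=
  @minset_exists _ (fun J : {set {set T}} => #|\bigcap_(B in J) hull pt B| < k)%N
    I0 small.
have [i _|i iJ|X [cX extX subX]] :=
  @critical_vertices _ _ _ pt pt_inj _ J (hull pt) _ _ erefl.
- exact: hull_hull.
- apply/eqP => e; have /Jmin : (#|\bigcap_(l in J :\ i) hull pt l| < k)%N.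
    by rewrite e.
  by move/(_ (subsetDl _ _))/setP/(_ i); rewrite !inE eqxx iJ.
have Jh : (#|J| <= h)%N.
  rewrite -cX; apply: vertices_leq extX _.
  exact: leq_ltn_trans (subset_leq_card subX) Jsmall.
have : (#|A| <= #|\bigcap_(B in J) hull pt B| + #|J| * n)%N.
  apply: (@leq_trans (#|\bigcap_(B in J) hull pt B|
      + #|\bigcup_(B in J) (A :\: B)|)).
    apply: leq_trans (leq_card_setU _ _); apply/subset_leq_card/subsetP => x xA.
    rewrite inE orbC; case: (boolP (x \in _)) => //= xU; apply/bigcapP => B BJ.
    apply: (subsetP (sub_hull pt B)); apply: contraNT xU => xB.
    by apply/bigcupP; exists B => //; rewrite inE xB.
  rewrite leq_add2l; apply: card_bigcup_leq => B /(subsetP sJ).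
  by rewrite inE => /andP[].
have : (#|J| * n <= h * n)%N by rewrite leq_mul2r Jh orbT.
by lia.
Qed.

(** If [v] lies between each point [x] of [X] and a point [z] of the hull of
[B], then [x - v] is a negative multiple of [z - v]. Since [v] is in the hull of
[X], a positive combination of the vectors [x - v] vanishes, hence so does one
of the vectors [z - v], and [v] would be in the hull of [B]. *)
Lemma opposite_points B X v : in_hull pt X v -> ~ in_hull pt B v ->
    (forall x, x \in X -> in_hull pt (x |: B) v) ->
  exists2 x, x \in X & pt x = v.
Proof.
move=> [w [w0 wX w1 wv]] vB XB; apply: contrapT => noX.
have sB x : (x |: B) :\ x \subset B.
  by apply/subsetP => y; rewrite !inE => /andP[/negPf ->].
have /choice[cz Hcz] : forall x, exists cz : R * V, x \in X ->
    [/\ 0 < cz.1, in_hull pt B cz.2 & pt x = v - cz.1 *: (cz.2 - v)].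
  move=> x; case: (boolP (x \in X)) => [xX|_]; last by exists (0, 0).
  have [ev|[a [z [/andP[a0 a1] /(in_hullS (sB x)) hz ev]]]] :=
    in_hull_split x (XB x xX); first by case: noX; exists x.
  have ap : 0 < a.
    rewrite lt0r a0 andbT; apply/eqP => az; apply: vB.
    by rewrite ev az scale0r add0r subr0 scale1r.
  exists ((1 - a) / a, z) => _; split => //=; first by rewrite divr_gt0 ?subr_gt0.
  apply: (scalerI (lt0r_neq0 ap)); rewrite scalerBr scalerA.
  rewrite mulrCA mulfV ?mulr1 ?lt0r_neq0 // scalerBr.
  have -> : (1 - a) *: z = v - a *: pt x by rewrite {1}ev addrAC subrr add0r.
  rewrite scalerBl scale1r !opprB addrA [X in X + _]addrCA subrr addr0.
  by rewrite addrC subrK.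
pose c x := w x * (cz x).1.
have wN x : w x != 0 -> x \in X by apply: contraNT => /wX ->.
have c0 x : 0 <= c x.
  rewrite /c; have [->|/wN/Hcz[/ltW z0 _ _]] := eqVneq (w x) 0.
    by rewrite mul0r.
  by rewrite mulr_ge0.
have cN x : c x != 0 -> in_hull pt B (cz x).2.
  rewrite /c mulf_eq0 negb_or => /andP[/wN/Hcz[]] //.
have cs : 0 < \sum_x c x.
  rewrite lt0r sumr_ge0 // andbT psumr_neq0 //.
  have : \sum_x w x != 0 by rewrite w1 oner_eq0.
  rewrite psumr_neq0 // => /hasP[x xT /= wx]; apply/hasP; exists x => //=.
  by rewrite mulr_gt0 //; have /Hcz[] := wN x (lt0r_neq0 wx).
have ez : \sum_x c x *: (cz x).2 = (\sum_x c x) *: v.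
  apply/eqP; rewrite -subr_eq0 scaler_suml -sumrB -oppr_eq0; apply/eqP.
  transitivity (\sum_x w x *: (pt x - v)).
    rewrite -sumrN; apply: eq_bigr => x _.
    rewrite -scalerBr -scalerN /c -scalerA.
    have [->|/wN/Hcz[_ _ ->]] := eqVneq (w x) 0; first by rewrite !scale0r.
    by congr (_ *: _); rewrite scalerN addrAC subrr add0r.
  under eq_bigr do rewrite scalerBr.
  by rewrite sumrB wv -scaler_suml w1 scale1r subrr.
apply: vB; have -> : v = \sum_x ((\sum_y c y)^-1 * c x) *: (cz x).2.
  under eq_bigr do rewrite -scalerA.
  by rewrite -scaler_sumr ez scalerA mulVf ?scale1r ?lt0r_neq0.
apply: in_hull_sum.
- by move=> x; rewrite mulr_ge0 // invr_ge0 ltW.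
- by rewrite -mulr_sumr mulVf ?lt0r_neq0.
- by move=> x; rewrite mulf_eq0 negb_or => /andP[_ /cN].
Qed.

Hypothesis pt_inj : injective pt.

(** Each [G i] lowers the depth by [s] only, even if it has [s + 1] points. Take
[B] maximal in [A], containing what remains after the removal, with [p] outside
its hull. By maximality [opposite_points] applies to a [G i] disjoint from [B],
forcing [p] into [G i]; so [B] misses at most [s] points of each [G i], which
contradicts the depth of [p]. *)
Lemma deep_survives (I : finType) (G : I -> {set T}) A n s p :
    deep A n p ->
    (forall i, [/\ G i \subset A, in_hull pt (G i) (pt p), (#|G i| <= s.+1)%N
        & p \in G i -> (#|G i| <= s)%N]) ->
    (#|I| * s <= n)%N ->
  in_hull pt (A :\: \bigcup_i G i) (pt p).
Proof.
move=> deepp HG Isn; apply: contrapT => pU.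
pose avoids B := (B \subset A) && ~~ `[< in_hull pt B (pt p) >].
have /maxset_exists[B /maxsetP[/andP[sBA /asboolP pB] Bmax] sUB] :
    avoids (A :\: \bigcup_i G i).
  by rewrite /avoids subsetDl; apply/asboolP.
have few i : (#|G i :\: B| <= s)%N.
  have [sGA pG cG pGs] := HG i.
  have [GB0|] := set_0Vmem (G i :&: B); last first.
    move=> [g /setIP[gG gB]]; rewrite -ltnS (leq_trans _ cG) //.
    rewrite proper_card // properE subsetDl; apply/subsetPn; exists g => //.
    by rewrite inE gB.
  apply: leq_trans (subset_leq_card (subsetDl _ _)) _; apply: pGs.
  have [g gG] : exists2 g, g \in G i & pt g = pt p; last first.
    by move/pt_inj => <-.
  apply: opposite_points pG pB _ => g gG; apply: contrapT => gB.
  have : g |: B = B.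
    apply: Bmax; last exact: subsetUr.
    rewrite /avoids subUset sub1set (subsetP sGA) // sBA /=.
    exact/asboolP.
  move=> /setP/(_ g); rewrite setU11 => /esym gB'.
  by have /setP/(_ g) := GB0; rewrite !inE gG gB'.
apply: pB; apply: deepp => //; apply: leq_trans Isn.
apply: (@leq_trans #|\bigcup_(i in [set: I]) (G i :\: B)|).
  apply/subset_leq_card/subsetP => x /setDP[xA xB].
  have : x \notin A :\: \bigcup_i G i by apply: contra xB; apply: (subsetP sUB).
  rewrite inE xA andbT negbK => /bigcupP[i _ xG].
  by apply/bigcupP; exists i; rewrite inE // xB.
by rewrite -cardsT; apply: card_bigcup_leq.
Qed.
End Depth.

(** * Disjoint subsets whose hulls contain given deep points *)

Section DisjointParts.
Variables (R : realFieldType) (d : nat) (T : finType).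

Lemma linear_dependence (g : T -> 'rV[R]_d) (Y : {set T}) : (d < #|Y|)%N ->
  exists mu : T -> R, [/\ forall t, t \notin Y -> mu t = 0,
    \sum_t mu t *: g t = 0 & exists t, mu t != 0].
Proof.
move=> dY; have [y0 y0Y] : exists y, y \in Y.
  by apply/card_gt0P; apply: leq_trans dY.
pose M := \matrix_(i < #|Y|) g (enum_val i).
have : kermx M != 0.
  rewrite -mxrank_eq0 mxrank_ker -lt0n subn_gt0.
  exact: leq_ltn_trans (rank_leq_col M) dY.
case/rowV0Pn => u /sub_kermxP uM un0.
pose mu t := if t \in Y then u 0 (enum_rank_in y0Y t) else 0.
have muE i : mu (enum_val i) = u 0 i.
  by rewrite /mu enum_valP enum_valK_in.
exists mu; split.
- by rewrite /mu => t /negPf ->.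
- rewrite (bigID (mem Y)) /= [X in _ + X]big1 ?addr0; last first.
    by move=> t /negPf tY; rewrite /mu tY scale0r.
  rewrite big_enum_val -[RHS]uM mulmx_sum_row; apply: eq_bigr => i _.
  by rewrite muE rowK.
- have /existsP[i ui] : [exists i, u 0 i != 0].
    apply: contraNT un0 => /existsPn u0; apply/eqP/rowP => i; rewrite mxE.
    by apply/eqP; rewrite -[_ == _]negbK u0.
  by exists (enum_val i); rewrite muE.
Qed.

Variable pt : T -> 'rV[R]_d.
Implicit Types (A X Y P : {set T}) (a p t : T) (v : 'rV[R]_d).

(** Prescribing one vertex costs nothing: the [d] others are those of a
Carathéodory reduction of the vectors [pt t - pt a]. *)
Lemma caratheodory_from a X v : a \in X -> in_hull pt X v ->
  exists Y, [/\ Y \subset X, (#|Y| <= d)%N & in_hull pt (a |: Y) v].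
Proof.
move=> aX hv; pose ok Y := `[< in_hull pt (a |: Y) v >].
have /minset_exists[Y /minsetP[/asboolP[w [w0 wY w1 wv]] Ymin] sYX] : ok (X :\ a).
  by apply/asboolP; rewrite setD1K.
exists Y; split.
- exact: subset_trans sYX (subsetDl _ _).
- rewrite leqNgt; apply/negP => dY.
  have aY : a \notin Y by apply/negP => /(subsetP sYX); rewrite !inE eqxx.
  have [mu0 [mu0Y mu0g [t1 mut1]]] := linear_dependence (fun t => pt t - pt a) dY.
  (* The weight at a must not decrease when w is moved along - mu, with a
     absorbing the total of mu; hence the choice of sign. *)
  have [mu [muY mug mus [t2 mut2]]] : exists mu : T -> R,
      [/\ forall t, t \notin Y -> mu t = 0, \sum_t mu t *: (pt t - pt a) = 0,
          0 <= \sum_t mu t & exists t, mu t != 0].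
    have [s0|s0] := leP 0 (\sum_t mu0 t).
      by exists mu0; split => //; exists t1.
    exists (fun t => - mu0 t); split.
    - by move=> t /mu0Y ->; rewrite oppr0.
    - by under eq_bigr do rewrite scaleNr; rewrite sumrN mu0g oppr0.
    - by rewrite sumrN oppr_ge0 ltW.
    - by exists t1; rewrite oppr_eq0.
  set s := \sum_t mu t in mus.
  have [t3 mut3] : exists t, 0 < mu t.
    apply: contrapT => nopos.
    have mule t : 0 <= - mu t.
      by rewrite oppr_ge0 leNgt; apply/negP => pos; apply: nopos; exists t.
    have /eqP : \sum_t - mu t = 0.
      apply/eqP; rewrite eq_le sumrN oppr_le0 mus /=.
      by rewrite -sumrN; apply: sumr_ge0.
    rewrite psumr_eq0 // => /allP/(_ t2 (mem_index_enum _)) /=.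
    by rewrite oppr_eq0 (negPf mut2).
  (* The largest step keeping all weights nonnegative kills the one at t0. *)
  case: (@arg_minP _ _ T t3 (fun t => 0 < mu t) (fun t => w t / mu t) mut3).
  move=> t0 mut0 tmin; set tau := w t0 / mu t0 in tmin.
  have tau0 : 0 <= tau by rewrite divr_ge0 // ltW.
  have t0Y : t0 \in Y by apply: contraTT mut0 => /muY ->; rewrite ltxx.
  have t0a : t0 != a by apply: contraNneq aY => <-.
  have : Y :\ t0 = Y.
    apply: Ymin; last exact: subsetDl.
    apply/asboolP; exists (fun t => w t - tau * mu t + (t == a)%:R * (tau * s)).
    split.
    - move=> t; apply: addr_ge0; last by rewrite mulr_ge0 ?ler0n // mulr_ge0.
      rewrite subr_ge0; have [pos|neg] := ltP 0 (mu t).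
        by rewrite -ler_pdivlMr // tmin.
      by rewrite (le_trans _ (w0 t)) // mulr_ge0_le0.
    - move=> t; rewrite !inE negb_or negb_and negbK => /andP[ta].
      rewrite (negPf ta) mul0r addr0 => /orP[/eqP ->|tY].
        by rewrite /tau divfK ?subrr // gt_eqF.
      by rewrite muY // wY ?mulr0 ?subr0 // !inE negb_or ta.
    - rewrite big_split /= sumrB w1 -mulr_sumr -/s -mulr_suml.
      rewrite (bigD1 a) //= eqxx big1 ?addr0 ?mul1r ?subrK // => t /negPf ->.
      exact: erefl.
    - under eq_bigr do rewrite scalerDl scalerBl.
      rewrite big_split /= sumrB wv.
      under [X in _ - X]eq_bigr do rewrite -scalerA.
      rewrite -scaler_sumr.
      rewrite [X in _ + X](bigD1 a) //= eqxx mul1r.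
      rewrite [X in _ + (_ + X)]big1; last first.
        by move=> t /negPf ->; rewrite mul0r scale0r.
      have : \sum_t mu t *: pt t - s *: pt a = 0.
        rewrite /s scaler_suml -sumrB -[RHS]mug.
        by apply: eq_bigr => t _; rewrite scalerBr.
      by move/subr0_eq => ->; rewrite addr0 scalerA subrK.
  by move/setP/(_ t0); rewrite !inE eqxx t0Y.
- by exists w.
Qed.

Lemma hull_nonempty X v : in_hull pt X v -> exists x, x \in X.
Proof.
move=> [w [_ wX w1 _]]; apply/set0Pn; apply/eqP => X0.
have := oner_neq0 R; rewrite -w1 big1 ?eqxx // => t _.
by apply: wX; rewrite X0 inE.
Qed.

(** A common vertex [a] serves all the points of [P], each of which needs [d]
more. If some point of [P] belongs to [X], it is taken as [a]; it then needs no
further vertex, which saves [d >= 1] points. *)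
Lemma hull_cover X P : (0 < d)%N -> P != set0 ->
    (forall p, p \in P -> in_hull pt X (pt p)) ->
  exists Y, [/\ Y \subset X, forall p, p \in P -> in_hull pt Y (pt p),
    (#|Y| <= (#|P| * d).+1)%N &
    forall p, p \in P -> p \in Y -> (#|Y| <= #|P| * d)%N].
Proof.
move=> d0 /set0Pn[p0 p0P] hP.
have [a0 a0X] := hull_nonempty (hP p0 p0P).
have from a : a \in X -> exists F : T -> {set T}, forall p, p \in P ->
    [/\ F p \subset X, (#|F p| <= d)%N & in_hull pt (a |: F p) (pt p)].
  move=> aX; have /choice[F HF] : forall p, exists Y : {set T}, p \in P ->
      [/\ Y \subset X, (#|Y| <= d)%N & in_hull pt (a |: Y) (pt p)].
    move=> p; case: (boolP (p \in P)) => [/hP hp|_]; last by exists set0.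
    by have [Y HY] := caratheodory_from aX hp; exists Y.
  by exists F.
have build a (F : T -> {set T}) (Q : {set T}) : a \in X -> Q \subset P ->
    (forall p, p \in P -> [/\ F p \subset X, (#|F p| <= d)%N
        & in_hull pt (a |: F p) (pt p)]) ->
    let Y := a |: \bigcup_(p in Q) F p in
    [/\ Y \subset X, forall p, p \in Q -> in_hull pt Y (pt p) &
      (#|Y| <= (#|Q| * d).+1)%N].
  move=> aX /subsetP sQP HF Y; split.
  - rewrite subUset sub1set aX; apply/bigcupsP => p /sQP/HF[] //.
  - move=> p pQ; have [_ _] := HF p (sQP p pQ); apply: in_hullS.
    by apply: setUS; apply: bigcup_sup.
  - rewrite (leq_trans (leq_card_setU _ _)) // cards1 ltnS.
    by apply: card_bigcup_leq => p /sQP/HF[].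
have [/existsP[p1 /andP[p1P p1X]]|/existsPn noPX] :=
    boolP [exists p, (p \in P) && (p \in X)].
  have [F HF] := from p1 p1X.
  have [sYX hY cY] := build p1 F (P :\ p1) p1X (subsetDl _ _) HF.
  have cY' : (#|p1 |: \bigcup_(p in P :\ p1) F p| <= #|P| * d)%N.
    apply: leq_trans cY _.
    rewrite [X in (_ <= X * _)%N](cardsD1 p1) p1P mulnDl mul1n.
    by rewrite -add1n leq_add2r.
  eexists; split; [exact: sYX| |exact: leqW|by []].
  move=> p pP; have [->|pp1] := eqVneq p p1.
    by apply: in_hull_pt; exact: setU11.
  by apply: hY; rewrite !inE pp1.
have [F HF] := from a0 a0X.
have [sYX hY cY] := build a0 F P a0X (subxx _) HF.
eexists; split; [exact: sYX|exact: hY|exact: cY|].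
move=> p pP /(subsetP sYX) pX; by have := noPX p; rewrite pP pX.
Qed.

Hypothesis pt_inj : injective pt.

(** The sets [G i] are chosen greedily: [deep_survives] guarantees that
[hull_cover] can be applied to what is left after each removal. *)
Lemma tverberg_deep A P n r : (0 < d)%N -> P != set0 ->
    (forall p, p \in P -> deep pt A n p) -> (r * (#|P| * d) <= n)%N ->
  exists G : 'I_r -> {set T},
    [/\ forall i, G i \subset A, forall i j, i != j -> [disjoint G i & G j],
        forall i p, p \in P -> in_hull pt (G i) (pt p) &
        forall p, p \in P -> in_hull pt (A :\: \bigcup_i G i) (pt p)].
Proof.
move=> d0 P0 deepP; set s := (#|P| * d)%N.
pose good (G : {set T}) := G \subset A /\ forall p, p \in P ->
  [/\ in_hull pt G (pt p), (#|G| <= s.+1)%N & p \in G -> (#|G| <= s)%N].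
have remain q (G : 'I_q -> {set T}) : (q * s <= n)%N -> (forall i, good (G i)) ->
    forall p, p \in P -> in_hull pt (A :\: \bigcup_i G i) (pt p).
  move=> qs goodG p pP.
  apply: (deep_survives pt_inj (s := s) (deepP p pP)); last by rewrite card_ord.
  by move=> i; have [GA /(_ p pP)[]] := goodG i.
move=> rs; suff [G [goodG Gdis]] : exists G : 'I_r -> {set T},
    (forall i, good (G i)) /\ forall i j, i != j -> [disjoint G i & G j].
  exists G; split => //; last exact: remain.
    by move=> i; case: (goodG i).
  by move=> i p pP; have [_ /(_ p pP)[]] := goodG i.
elim: r rs => [|q IHq] rs; first by exists (fun=> set0); split; case.
have qs : (q * s <= n)%N by apply: leq_trans rs; rewrite leq_mul2r leqnSn orbT.
have [G [goodG Gdis]] := IHq qs.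
have [Y [sY hY cY cYs]] := hull_cover d0 P0 (remain q G qs goodG).
have disY i : [disjoint G i & Y].
  rewrite disjoints_subset; apply/subsetP => x xG; rewrite inE.
  apply/negP => /(subsetP sY); rewrite inE => /andP[/bigcupP[]].
  by exists i.
exists (fun i => if unlift ord_max i is Some j then G j else Y); split.
- move=> i; case: unliftP => [j _|_] //; split.
    exact: subset_trans sY (subsetDl _ _).
  by move=> p pP; split; [exact: hY|exact: cY|exact: cYs pP].
- move=> i j; case: unliftP => [i' ->|->]; case: unliftP => [j' ->|->] //.
  + by move=> ne; apply: Gdis; apply: contra ne => /eqP ->.
  + by rewrite disjoint_sym.
  + by rewrite eqxx.
Qed.
End DisjointParts.

(** * From indexed points to sets of vectors *)

Lemma in_hull_convex (R : realType) (V : lmodType R) (T : finType) (pt : T -> V)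
    (X : {set T}) (D : set V) v :
  convex_set D -> (forall x, x \in X -> D (pt x)) -> in_hull pt X v -> D v.
Proof.
move=> cD; have [n] := ubnP #|X|; elim: n => // n IHn in X v *.
rewrite ltnS => Xn XD hv; have [X0|[x xX]] := set_0Vmem X.
  have [w [_ wX w1 _]] := hv; have := oner_neq0 R.
  by rewrite -w1 big1 ?eqxx // => t _; apply: wX; rewrite X0 inE.
have [->|[a [z [/andP[a0 a1] hz ->]]]] := in_hull_split x hv; first exact: XD.
have Dz : D z.
  apply: (IHn (X :\ x)) hz.
    by apply: leq_trans Xn; rewrite [X in (_ < X)%N](cardsD1 x) xX.
  by move=> y /setD1P[_ /XD].
have := cD (pt x) z (Itv01 a0 (ltW a1)) (mem_set (XD x xX)) (mem_set Dz).
by move/set_mem.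
Qed.

Lemma in_hull_conv_hull (R : realType) (V : lmodType R) (T : finType)
    (pt : T -> V) (X : {set T}) (D : set V) v :
  (forall x, x \in X -> D (pt x)) -> in_hull pt X v -> conv_hull D v.
Proof.
by move=> XD hv B [cB DB]; apply: in_hull_convex cB _ hv => x /XD; apply: DB.
Qed.

(** A translation by [Z] in all coordinates makes finitely many integer points
nonnegative. *)
Lemma int_grid (R : realType) d n (s : 'I_n -> 'rV[R]_d) :
    (forall i, s i \is a mxOver Num.int) ->
  exists M Z (f : 'I_n -> {ffun 'I_d -> 'I_M}), forall i, grid_pt R Z (f i) = s i.
Proof.
move=> sint.
have /choice[z zE] : forall ij, exists z : int, s ij.1 0 ij.2 = z%:~R.
  by move=> [i j]; have /mxOverP/(_ 0 j)/intrP := sint i.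
pose Z := (\sum_ij `|z ij|)%N.
have zZ ij : (`|z ij| <= Z)%N by rewrite /Z (bigD1 ij) //= leq_addr.
have zM ij : (`|(z ij + Z)%R| < (2 * Z).+1)%N by have := zZ ij; lia.
exists (2 * Z).+1, Z, (fun i => [ffun j => Ordinal (zM (i, j))]) => i.
apply/rowP => j; rewrite !mxE ffunE /= (zE (i, j)).
have : (0 <= z (i, j) + Z)%R by have := zZ (i, j); lia.
by move=> /gez0_abs e; rewrite pmulrn e intrD -pmulrn addrK.
Qed.

Lemma grid_pt_lattice (R : realType) d M Z (f : {ffun 'I_d -> 'I_M}) :
  lattice R d (grid_pt R Z f).
Proof.
apply/mxOverP => i j; rewrite mxE; apply: rpredB; exact: natr_int.
Qed.

End FiniteConvexity.

Local Open Scope classical_set_scope.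
Local Open Scope card_scope.

Theorem corollary1p1 (R : realType) (d k m : nat)
    (hd : (1 <= d)%N) (hk : (1 <= k)%N) (hm : (1 <= m)%N)
    (S : set 'rV[R]_d) (hS : S `<=` lattice R d)
    (hcard : `I_(c d k * (m - 1) * k * d + k)%N #<= S) :
  exists F : 'I_m -> set 'rV[R]_d,
    partition [set: 'I_m] F S /\
    `I_k #<= (\bigcap_(i in [set: 'I_m]) conv_hull (F i)) `&` lattice R d.
Proof.
case: m hm hcard => // r _; rewrite subn1 /=.
set N := (_ + k)%N => /card_leP[g0].
pose s (i : 'I_N) : 'rV[R]_d := \val (g0 (SigSub (mem_set (ltn_ord i : `I_N i)))).
have sS i : S (s i) by apply: set_mem (valP _).
have s_inj : injective s.
  move=> i j /val_inj/(@inj _ _ _ g0); rewrite !inE => /(_ I I).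
  by move/(congr1 val) => /=; apply: ord_inj.
have [M [Z [f fE]]] := int_grid (fun i => hS _ (sS i)).
pose pt := grid_pt R Z (M := M) (d := d).
have pt_inj : injective pt by apply: grid_pt_inj.
pose A := [set f i | i : 'I_N]%SET.
have f_inj : injective f by move=> i j e; apply: s_inj; rewrite -!fE e.
have cA : #|A| = N by rewrite card_imset // card_ord.
have AS t : t \in A -> S (pt t) by case/imsetP => i _ ->; rewrite /pt fE.
have [|P cP deepP] := exists_deep_points (h := c d k) (n := r * (k * d))
  pt_inj (fun X => @card_vertices R d M Z X k hd) _ (A := A).
  by rewrite cA /N; lia.
have P0 : P != finset.set0 by rewrite -card_gt0 cP.
have [|G [GA Gdis GP UP]] := tverberg_deep pt_inj hd P0 deepP (r := r).
  by rewrite cP.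
(* S may be infinite; what is left of it goes to the last part. *)
pose F (i : 'I_r.+1) : set 'rV[R]_d :=
  if unlift ord_max i is Some j then [set pt t | t in [set` G j]]
  else S `\` \bigcup_j [set pt t | t in [set` G j]].
have GS j : [set pt t | t in [set` G j]] `<=` S.
  by move=> _ [t /= tG <-]; apply: AS; apply: (fintype.subsetP (GA j)).
have hullF i t : t \in P -> conv_hull (F i) (pt t).
  move=> tP; rewrite /F; case: unliftP => [j _|_].
    by apply: in_hull_conv_hull (GP j t tP) => x xG; exists x.
  apply: in_hull_conv_hull (UP t tP) => x; rewrite finset.inE => /andP[xU xA].
  split; first exact: AS.
  case=> j _ [y yG /pt_inj exy]; move: xU; rewrite -exy => /negP; apply.
  by apply/finset.bigcupP; exists j.
have [p pP] : exists p, p \in P by apply/set0Pn.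
exists F; split; last first.
  pose q n := nth p (enum P) n.
  have sP : size (enum P) = k by rewrite -cardE.
  have q_inj : {in `I_k &, injective (pt \o q)}.
    move=> a b; rewrite !inE /= => ak bk /pt_inj/eqP.
    by rewrite nth_uniq ?enum_uniq ?sP // => /eqP.
  rewrite -(card_le_eql (inj_card_eq q_inj)); apply: subset_card_le.
  move=> _ [n /= nk <-]; split; last exact: grid_pt_lattice.
  by move=> i _; apply: hullF; rewrite -mem_enum mem_nth ?sP.
split.
- apply/seteqP; split=> [x [i _]|x Sx].
    rewrite /F; case: unliftP => [j _|_]; first exact: GS.
    by case.
  have [[j _ Gx]|nGx] := pselect ((\bigcup_j [set pt t | t in [set` G j]]) x).
    by exists (lift ord_max j); rewrite // /F liftK.
  by exists ord_max => //; rewrite /F unlift_none.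
- move=> i j _ _; rewrite /F.
  case: unliftP => [i' ->|->]; case: unliftP => [j' ->|->] //.
  + move=> [x [[t /= tG <-] [u /= uG /pt_inj eut]]]; congr lift; apply/eqP.
    by apply/negPn/negP => /Gdis/disjointFr/(_ tG); rewrite -eut uG.
  + by move=> [x [Gx [_ nG]]]; case: nG; exists i'.
  + by move=> [x [[_ nG] Gx]]; case: nG; exists j'.
- move=> i _; apply: contrapT => /set0P/negP/negPn/eqP Fi0.
  have := hullF i p pP; rewrite Fi0 => /(_ set0); apply; split=> //.
Qed.
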